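(* Let $\Omega=\{x_1,\dots,x_n\}$ be a set of $n$ distinct points of $\mathbb{R}$, let $1\le m\le n$, and let $\boldsymbol{L}_\varepsilon=[\kappa_\varepsilon(x_i,x_j)]_{i,j=1}^n$ with $\kappa$ a stationary kernel of smoothness order $r\ge m$ (possibly $r=\infty$). Then, as $\varepsilon\to0$ ($\varepsilon>0$), $\mathcal{X}_\varepsilon\sim|DPP|_m(\boldsymbol{L}_\varepsilon)$ converges to $\mathcal{X}_\star\sim|DPP|_m(\boldsymbol{V}_{\le m-1}\boldsymbol{V}_{\le m-1}^\top)$.
   Context: Kernel: a positive definite function $\kappa:\mathbb{R}\times\mathbb{R}\to\mathbb{R}$ (the matrix $[\kappa(y_i,y_j)]_{i,j}$ is positive definite for any finitely many distinct points $y_i$). It is stationary if $\kappa(x,y)=f(|x-y|)$ for a function $f$; $f$ is assumed analytic in a neighbourhood of $0$, $f(t)=\sum_{i\ge0}f_it^i$ with $f_i=f^{(i)}(0)/i!$, and $\kappa_\varepsilon(x,y)=f(\varepsilon|x-y|)$. Smoothness order: $r=\min\{r\ge1: f_{2r-1}\neq0\}$, with $r=\infty$ if all odd coefficients vanish. Vandermonde matrix: $\boldsymbol{V}_{\le k}=[x_i^{j}]_{1\le i\le n,\,0\le j\le k}\in\mathbb{R}^{n\times(k+1)}$. Fixed-size L-ensemble: for $\boldsymbol{L}$ positive semi-definite, $\mathcal{X}\sim|DPP|_m(\boldsymbol{L})$ is the random subset of $\Omega$ with $\mathbf{P}(\mathcal{X}=X)\propto\det(\boldsymbol{L}_X)$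 if $|X|=m$, and $0$ otherwise, where $\boldsymbol{L}_X$ is the principal submatrix indexed by $X$. Convergence: $\mathbf{P}(\mathcal{X}_\varepsilon=X)\to\mathbf{P}(\mathcal{X}_\star=X)$ for every $X\subseteq\Omega$. *)

(* Defs.v *)
From HB Require Import structures.
From mathcomp Require Import all_boot all_order all_algebra.
From mathcomp Require Import all_classical all_reals all_analysis.

Set Implicit Arguments.
Unset Strict Implicit.
Unset Printing Implicit Defensive.

Import Order.TTheory GRing.Theory Num.Theory.
Import numFieldNormedType.Exports.

Local Open Scope classical_set_scope.
Local Open Scope ring_scope.

Definition posdefmx (R : realType) (k : nat) (M : 'M[R]_k) : Prop :=
  M^T = M /\ forall v : 'cV[R]_k, v != 0 -> 0 < (v^T *m M *m v) 0 0.

Definition is_kernel (R : realType) (kappa : R -> R -> R) : Prop :=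
  forall (k : nat) (y : 'I_k -> R), injective y ->
    posdefmx (\matrix_(i < k, j < k) kappa (y i) (y j)).

Definition is_stationary (R : realType) (kappa : R -> R -> R) (f : R -> R)
    : Prop :=
  forall x y : R, kappa x y = f `|x - y|.

Definition taylor_coef (R : realType) (f : R -> R) (i : nat) : R :=
  derive1n i f 0 / i`!%:R.

(* [f] is a function on the whole line, so that its derivatives at 0 are
   two-sided; a stationary kernel only sees its values on [0, +oo[.
   [derive1n] is total, but convergence of the series to [f] near 0 forces [f]
   to be analytic there, so the coefficients are genuine derivatives. *)
Definition analytic_near0 (R : realType) (f : R -> R) : Prop :=
  exists2 rho : R, 0 < rho & forall t : R, `|t| < rho ->
    [series taylor_coef f i * t ^+ i]_i @ \oo --> f t.

Definition scaled_kernel (R : realType) (f : R -> R) (e x y : R) : R :=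
  f (e * `|x - y|).

Definition nonzero_odd_coef (R : realType) (f : R -> R) (r : nat) : bool :=
  (1 <= r)%N && (taylor_coef f (2 * r - 1) != 0).

(* [None] stands for infinite smoothness order. *)
Definition smoothness_order (R : realType) (f : R -> R) : option nat :=
  match pselect (exists r, nonzero_odd_coef f r) with
  | left h => Some (ex_minn h)
  | right _ => None
  end.

Definition order_at_least (m : nat) (r : option nat) : bool :=
  if r is Some k then (m <= k)%N else true.

Definition kernel_mx (R : realType) (n : nat) (K : R -> R -> R)
    (x : 'I_n -> R) : 'M[R]_n :=
  \matrix_(i < n, j < n) K (x i) (x j).

(* The library's Vandermonde matrix has one column, not one row, per point. *)
Definition vandermonde_le (R : realType) (n : nat) (x : 'I_n -> R) (k : nat)
    : 'M[R]_(n, k.+1) :=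
  (Vandermonde k.+1 (\row_(i < n) x i))^T.

Definition principal_submx (R : realType) (n : nat) (L : 'M[R]_n)
    (A : {set 'I_n}) : 'M[R]_#|A| :=
  mxsub (@enum_val _ (mem A)) (@enum_val _ (mem A)) L.

(* Subsets of a ground set of n points are identified with sets of indices.
   The proportionality constant [c] is determined by [P] having total mass 1. *)
Definition fixed_size_Lensemble (R : realType) (d : measure_display)
    (T : measurableType d) (P : probability T R) (n : nat)
    (X : T -> {set 'I_n}) (m : nat) (L : 'M[R]_n) : Prop :=
  (forall A : {set 'I_n}, measurable (X @^-1` [set A])) /\
  exists c : R, forall A : {set 'I_n},
    P (X @^-1` [set A]) =
      (if #|A| == m then c * \det (principal_submx L A) else 0)%:E.

(* Main.v *)
Require Import Defs.
From HB Require Import structures.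
From mathcomp Require Import all_boot all_order all_algebra.
From mathcomp Require Import all_classical all_reals all_analysis.
From mathcomp Require Import ring lra zify.

(** A set [A] of [m] points has probability proportional to the minor
    [det L_A], so only the ratios of the minors matter.  Let [U] be the square
    Vandermonde matrix of the points of [A].  The columns of [U^-1] are the
    point functionals dual to the monomials.  A congruence of [L_A] by
    [U^-1 * diag (e ^ -i)] turns it into a matrix that converges to

      [W i j = (-1) ^ j * binomial (i + j, i) * f_(i + j)],  [i, j < m],

    the coefficients of [x ^ i * y ^ j] in the Taylor expansion of [f (x - y)]:
    the odd coefficients of [f] below [2 m - 1] vanish, so up to an error
    [O(e ^ (2 m - 1))] the kernel is a polynomial in [x] and [y]
    ([flat_limit_entry]).  Hence [det L_A] is a factor that depends only on
    [e] and [m], times [det W * (det U) ^ 2 + o(1)] ([flat_limit_det]).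
    Since [(det U) ^ 2] is the minor of the limit ensemble, the theorem follows
    on dividing by the total mass, provided that [det W] is nonzero.

    This last fact ([wronskian_det_neq0]) is where strict positive definiteness
    of the kernel at finite distance is used.  If [v W = 0] with [v] nonzero,
    the functional with weights [U^-1 * diag (e ^ -i) * v^T] on a cluster of
    points of diameter [O(e)] has an energy tending to [0]; in the limit it is
    a differential operator that is null for the kernel.  By the
    Cauchy-Schwarz inequality it also kills the kernel centred at any other
    point, and comparing Taylor coefficients gives linear recurrences of order
    less than [m] for the derivatives of [f] at [0]
    ([flat_null_recurrence]).  Using test points on both sides of the cluster,
    the sequences [f^(n)(0)] and [(-1)^n f^(n)(0)] satisfy the same
    recurrence, so all odd coefficients vanish; and the Hankel matrices of
    [f^(n)(0)] have rank less than [m].  Then the kernel matrix of [m]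
    points near [0] is a limit of singular matrices ([square_truncation],
    [det_recurrence_eq0]), contradicting positive definiteness.

    The clusters and the test points are put at different powers of one small
    parameter [e], so that all estimates are of the form [O(e ^ k)] and no
    differentiation of [f] away from [0] is needed. *)

Import Order.TTheory GRing.Theory Num.Theory.
Import numFieldNormedType.Exports.

Local Open Scope classical_set_scope.
Local Open Scope ring_scope.

Set Implicit Arguments.
Unset Strict Implicit.
Unset Printing Implicit Defensive.

(** * Orders of vanishing at zero from the right *)

(** [d <= 1] makes a higher order imply a lower one with the same [C], [d]. *)
Definition bigO_pow (R : realType) (k : nat) (g : R -> R) : Prop :=
  exists C d : R, [/\ 0 <= C, 0 < d, d <= 1 &
    forall e, 0 < e < d -> `|g e| <= C * e ^+ k].

Lemma bigO_powI (R : realType) k (g : R -> R) (C d : R) : 0 < d ->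
  (forall e, 0 < e < d -> `|g e| <= C * e ^+ k) -> bigO_pow k g.
Proof.
move=> d0 H; exists `|C|, (Num.min d 1); split=> //.
- by rewrite lt_min d0 ltr01.
- by rewrite ge_min lexx orbT.
move=> e /andP[e0]; rewrite lt_min => /andP[ed _].
apply: le_trans (H e _) _; first by rewrite e0.
by rewrite ler_wpM2r ?exprn_ge0 ?ler_norm // ltW.
Qed.

Lemma bigO_pow_eq (R : realType) k (g h : R -> R) (d : R) : 0 < d ->
  (forall e, 0 < e < d -> g e = h e) -> bigO_pow k g -> bigO_pow k h.
Proof.
move=> d0 gh [C [d' [C0 d'0 _ H]]].
apply: (@bigO_powI _ _ _ C (Num.min d d')); first by rewrite lt_min d0.
move=> e /andP[e0]; rewrite lt_min => /andP[ed ed'].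
by rewrite -gh ?e0 // H ?e0.
Qed.

Lemma bigO_pow_ext (R : realType) k (g h : R -> R) :
  (forall e, 0 < e -> g e = h e) -> bigO_pow k g -> bigO_pow k h.
Proof.
move=> gh; apply: (@bigO_pow_eq _ _ _ _ 1) => // e /andP[e0 _]; exact: gh.
Qed.

Lemma bigO_powW (R : realType) k l (g : R -> R) : (l <= k)%N ->
  bigO_pow k g -> bigO_pow l g.
Proof.
move=> lk [C [d [C0 d0 d1 H]]]; apply: (@bigO_powI _ _ _ C d) => // e /[dup] ed.
move=> /andP[e0 e1]; apply: le_trans (H e ed) _; rewrite ler_wpM2l //.
by rewrite ler_wiXn2l ?ltW // (lt_le_trans e1).
Qed.

Lemma bigO_powD (R : realType) k (g h : R -> R) :
  bigO_pow k g -> bigO_pow k h -> bigO_pow k (fun e => g e + h e).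
Proof.
move=> [C [d [C0 d0 _ H]]] [C' [d' [C'0 d'0 _ H']]].
apply: (@bigO_powI _ _ _ (C + C') (Num.min d d')); first by rewrite lt_min d0.
move=> e /andP[e0]; rewrite lt_min => /andP[ed ed'].
rewrite (le_trans (ler_normD _ _)) // mulrDl lerD ?H ?H' ?e0 //.
Qed.

Lemma bigO_powM (R : realType) k l (g h : R -> R) :
  bigO_pow k g -> bigO_pow l h -> bigO_pow (k + l) (fun e => g e * h e).
Proof.
move=> [C [d [C0 d0 _ H]]] [C' [d' [C'0 d'0 _ H']]].
apply: (@bigO_powI _ _ _ (C * C') (Num.min d d')); first by rewrite lt_min d0.
move=> e /andP[e0]; rewrite lt_min => /andP[ed ed'].
rewrite normrM exprD mulrACA ler_pM ?H ?H' ?e0 //.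
Qed.

Lemma bigO_pow_cst (R : realType) (c : R) : bigO_pow 0 (fun _ : R => c).
Proof.
by apply: (@bigO_powI _ _ _ `|c| 1) => // e _; rewrite expr0 mulr1.
Qed.

Lemma bigO_powXn (R : realType) k : bigO_pow k (fun e : R => e ^+ k).
Proof.
apply: (@bigO_powI _ _ _ 1 1) => // e /andP[e0 _].
by rewrite mul1r ger0_norm // exprn_ge0 // ltW.
Qed.

Lemma bigO_powMl (R : realType) k (c : R) (g : R -> R) :
  bigO_pow k g -> bigO_pow k (fun e => c * g e).
Proof. exact: (bigO_powM (bigO_pow_cst c)). Qed.

Lemma bigO_powN (R : realType) k (g : R -> R) :
  bigO_pow k g -> bigO_pow k (fun e => - g e).
Proof.
move=> [C [d [C0 d0 _ H]]]; apply: (@bigO_powI _ _ _ C d) => // e ed.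
by rewrite normrN H.
Qed.

Lemma bigO_powB (R : realType) k (g h : R -> R) :
  bigO_pow k g -> bigO_pow k h -> bigO_pow k (fun e => g e - h e).
Proof. by move=> Og Oh; exact: bigO_powD (bigO_powN Oh). Qed.

Lemma bigO_pow0 (R : realType) k : bigO_pow k (fun _ : R => 0).
Proof.
by apply: (@bigO_powI _ _ _ 0 1) => // e _; rewrite normr0 mul0r.
Qed.

Lemma bigO_pow_sum (R : realType) k I (r : seq I) (Q : pred I)
    (g : I -> R -> R) :
  (forall i, Q i -> bigO_pow k (g i)) ->
  bigO_pow k (fun e => \sum_(i <- r | Q i) g i e).
Proof.
move=> H; elim: r => [|i r IH].
  by apply: bigO_pow_ext (bigO_pow0 R k) => e _; rewrite ?big_nil.
have [Qi|nQi] := boolP (Q i); last first.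
  by apply: bigO_pow_ext IH => e _; rewrite ?big_cons ?(negPf nQi).
by apply: bigO_pow_ext (bigO_powD (H i Qi) IH) => e _; rewrite ?big_cons ?Qi.
Qed.

Lemma bigO_pow_div (R : realType) k s (g : R -> R) : (s <= k)%N ->
  bigO_pow k g -> bigO_pow (k - s) (fun e => g e / e ^+ s).
Proof.
move=> sk [C [d [C0 d0 _ H]]]; apply: (@bigO_powI _ _ _ C d) => // e /[dup] ed.
move=> /andP[e0 _].
have es : 0 < e ^+ s by rewrite exprn_gt0.
rewrite normrM normfV (gtr0_norm es) ler_pdivrMr // -mulrA -exprD subnK //.
exact: H.
Qed.

Lemma bigO_pow_comp (R : realType) k s (g : R -> R) : (0 < s)%N ->
  bigO_pow k g -> bigO_pow (s * k) (fun e => g (e ^+ s)).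
Proof.
move=> s0 [C [d [C0 d0 d1 H]]]; apply: (@bigO_powI _ _ _ C d) => // e.
move=> /andP[e0 ed]; rewrite exprM H // exprn_gt0 //=.
apply: le_lt_trans (ed); rewrite -[leRHS]expr1 ler_wiXn2l ?(ltW e0) //.
exact: ltW (lt_le_trans ed d1).
Qed.

Lemma bigO_pow_sqr (R : realType) k (g : R -> R) :
  bigO_pow (2 * k) (fun e => g e ^+ 2) -> bigO_pow k g.
Proof.
move=> [C [d [C0 d0 d1 H]]]; apply: (@bigO_powI _ _ _ (C + 1) d) => // e ed.
have e0 : 0 <= e ^+ k by case/andP: ed => /ltW e0 _; rewrite exprn_ge0.
rewrite -ler_sqr ?nnegrE ?mulr_ge0 ?addr_ge0 // real_normK ?num_real //.
have := H e ed; rewrite ger0_norm ?sqr_ge0 // => /le_trans; apply.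
rewrite exprMn mulnC exprM ler_wpM2r ?sqr_ge0 //; nra.
Qed.

(** Compares coefficients: once the lower ones vanish, [b k] is the leading
    coefficient, and [b k * e ^ k = O(e ^ (k + 1))] forces it to be zero. *)
Lemma bigO_pow_poly_eq0 (R : realType) N K (b : nat -> R) :
  bigO_pow K (fun e => \sum_(k < N) b k * e ^+ k) ->
  forall k, (k < N)%N -> (k < K)%N -> b k = 0.
Proof.
move=> H; elim/ltn_ind => k IH kN kK.
have [C [d [C0 d0 d1 Hd]]] : bigO_pow k.+1 (fun e => b k * e ^+ k).
  pose o := Ordinal kN.
  have HS : bigO_pow k.+1 (fun e => \sum_(j < N | j != o) b j * e ^+ j).
    apply: bigO_pow_sum => j jo.
    have [jk|kj] := ltnP j k.
      apply: bigO_pow_ext (bigO_pow0 _ _) => e _.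
      by rewrite IH ?mul0r // (ltn_trans jk).
    apply: bigO_powMl; apply: bigO_powW (bigO_powXn _ _).
    by rewrite ltn_neqAle kj andbT eq_sym.
  have H' := bigO_powW kK H.
  apply: bigO_pow_ext (bigO_powB H' HS) => e _.
  by rewrite (bigD1 o) //= addrK.
apply/eqP; rewrite -normr_le0; apply/ler_addgt0Pr => x x0; rewrite add0r.
pose e := Num.min (d / 2) (x / (C + 1)).
have C1 : 0 < C + 1 by rewrite ltr_wpDl.
have e0 : 0 < e by rewrite lt_min !divr_gt0.
have ed : e < d by rewrite gt_min; apply/orP; left; lra.
have := Hd e; rewrite e0 ed => /(_ isT).
have ek : 0 < e ^+ k by rewrite exprn_gt0.
rewrite normrM (gtr0_norm ek) exprS mulrA ler_pM2r // => /le_trans; apply.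
have : e <= x / (C + 1) by rewrite ge_min lexx orbT.
rewrite ler_pdivlMr // mulrDr mulr1 [C * e]mulrC; lra.
Qed.

Lemma bigO_pow1_cvg (R : realType) (g : R -> R) (l : R) :
  bigO_pow 1 (fun e => g e - l) -> g e @[e --> 0^'+] --> l.
Proof.
move=> [C [d [C0 d0 d1 H]]]; apply/cvgrPdist_le => x x0.
have C1 : 0 < C + 1 by rewrite ltr_wpDl.
near=> e.
have e0 : 0 < e by near: e; exact: nbhs_right_gt.
have ed : e < d by near: e; exact: nbhs_right_lt.
have ex : e < x / (C + 1) by near: e; apply: nbhs_right_lt; rewrite divr_gt0.
rewrite distrC (le_trans (H e _)) ?e0 // expr1.
move: ex; rewrite ltr_pdivlMr // mulrDr mulr1 [C * e]mulrC; lra.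
Unshelve. all: by end_near. Qed.

(** * Power series: tails and binomial rearrangement *)

Lemma sum_geometric_le (R : realFieldType) (r : R) N M :
  0 <= r -> r <= 2^-1 -> \sum_(N <= n < M) r ^+ n <= 2 * r ^+ N.
Proof.
move=> r0 r1; have [MN|NM] := leqP M N.
  by rewrite big_geq // mulr_ge0 // exprn_ge0.
(* Keeping the bound [2 r ^ M] on the remaining tail makes the claim inductive. *)
suff H k : \sum_(N <= n < N + k) r ^+ n + 2 * r ^+ (N + k) <= 2 * r ^+ N.
  have := H (M - N)%N; rewrite subnKC ?(ltnW NM) //; apply: le_trans.
  by rewrite lerDl mulr_ge0 // exprn_ge0.
elim: k => [|k IH]; first by rewrite addn0 big_geq // add0r.
apply: le_trans IH; rewrite addnS big_nat_recr ?leq_addr //= -addrA lerD2l exprS.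
have : 0 <= r ^+ (N + k) by rewrite exprn_ge0.
nra.
Qed.

(** The witness [q^-1] is half the radius on which the series is known to converge, so that
    its terms at [q^-1] are bounded, and for [q * s <= 1/2] the tails are
    dominated by geometric ones.  The absolute tails serve to rearrange double
    series, the other ones to approximate [f]. *)
Lemma analytic_tail (R : realType) (f : R -> R) : analytic_near0 f ->
  exists B q : R, [/\ 0 <= B, 0 < q,
    forall s N M, 0 <= s -> q * s <= 2^-1 ->
      \sum_(N <= n < M) `|taylor_coef f n| * s ^+ n <= B * (q * s) ^+ N,
    forall t, q * `|t| <= 2^-1 ->
      [series taylor_coef f n * t ^+ n]_n @ \oo --> f t &
    forall t N, q * `|t| <= 2^-1 ->
      `|f t - \sum_(n < N) taylor_coef f n * t ^+ n| <= B * (q * `|t|) ^+ N].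
Proof.
move=> [rho rho0 fE]; pose t0 := rho / 2; set a := taylor_coef f.
have t00 : 0 < t0 by rewrite divr_gt0.
have [B B0 aB] : exists2 B, 0 <= B & forall n, `|a n| * t0 ^+ n <= B.
  have /cvg_series_bounded [B [Br HB]] :
      cvgn (series (fun n => a n * t0 ^+ n)).
    by apply/cvg_ex; exists (f t0); apply: fE; rewrite gtr0_norm // /t0; lra.
  exists `|B + 1| => // n; apply: le_trans (ler_norm _).
  have B1 : B < B + 1 by rewrite ltrDl.
  have /= := HB _ B1 n I.
  by rewrite normrM (ger0_norm (exprn_ge0 n (ltW t00))).
have tail s N M : 0 <= s -> t0^-1 * s <= 2^-1 ->
    \sum_(N <= n < M) `|a n| * s ^+ n <= (2 * B) * (t0^-1 * s) ^+ N.
  move=> s0 s1; have r0 : 0 <= t0^-1 * s by rewrite mulr_ge0 // invr_ge0 ltW.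
  apply: (@le_trans _ _ (B * \sum_(N <= n < M) (t0^-1 * s) ^+ n)).
    rewrite mulr_sumr; apply: ler_sum => n _.
    have -> : `|a n| * s ^+ n = (`|a n| * t0 ^+ n) * (t0^-1 * s) ^+ n.
      by rewrite -mulrA -exprMn mulrA mulfV ?mul1r // gt_eqF.
    by rewrite ler_wpM2r // exprn_ge0.
  rewrite [2 * B]mulrC -mulrA ler_wpM2l //; exact: sum_geometric_le.
have lim t : t0^-1 * `|t| <= 2^-1 ->
    [series a n * t ^+ n]_n @ \oo --> f t.
  move=> ht; apply: fE; move: ht; rewrite ler_pdivrMl // /t0.
  by move=> ht; apply: le_lt_trans ht _; lra.
exists (2 * B), t0^-1; split=> //; first by rewrite mulr_ge0.
  by rewrite invr_gt0.
move=> t N ht.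
have cvgd : `|[series a n * t ^+ n]_n M - \sum_(n < N) a n * t ^+ n| @[M --> \oo]
    --> `|f t - \sum_(n < N) a n * t ^+ n|.
  by apply: cvg_norm; apply: cvgB; [exact: lim | exact: cvg_cst].
apply: (cvgr_to_le cvgd); exists N => // M /= NM.
rewrite /series /= -[X in _ - X](big_mkord xpredT (fun n => a n * t ^+ n)).
rewrite (big_cat_nat (leq0n N) NM) /= addrAC subrr add0r.
apply: le_trans (ler_norm_sum _ _ _) _.
under eq_bigr do rewrite normrM normrX.
exact: tail.
Qed.

Lemma bigO_pow_taylor (R : realType) (f h : R -> R) N : analytic_near0 f ->
  bigO_pow 1 h ->
  bigO_pow N (fun e => f (h e) - \sum_(n < N) taylor_coef f n * h e ^+ n).
Proof.
move=> /analytic_tail[B [q [B0 q0 _ _ H]]] [C [d [C0 d0 d1 Hh]]].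
(* This radius puts [h e], bounded by [C * e], where the tail bounds hold. *)
have c0 : 0 < (q * (C + 1) * 2)^-1.
  by rewrite invr_gt0 !mulr_gt0 // ltr_wpDl.
apply: (@bigO_powI _ _ _ (B * (q * C) ^+ N) (Num.min d (q * (C + 1) * 2)^-1)).
  by rewrite lt_min d0 c0.
move=> e /andP[e0]; rewrite lt_min => /andP[ed ec].
have he : `|h e| <= C * e by rewrite -[e in C * e]expr1 Hh // e0.
have qh : q * `|h e| <= q * C * e by rewrite -mulrA ler_wpM2l // ltW.
apply: le_trans (H _ _ _) _.
  apply: le_trans qh _; move: ec; rewrite -[ltRHS]mul1r ltr_pdivlMr; last first.
    by rewrite !mulr_gt0 // ltr_wpDl.
  have qe : 0 < q * e by rewrite mulr_gt0.
  have -> : e * (q * (C + 1) * 2) = 2 * (q * C * e) + 2 * (q * e) by ring.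
  lra.
rewrite -mulrA ler_wpM2l // -exprMn.
have [q0' e0'] := (ltW q0, ltW e0).
by apply: lerXn2r; rewrite ?nnegrE ?mulr_ge0 ?mulr_ge0.
Qed.

(** The triangle [i + j < N] is cut out of a square of arbitrary side [M >= N], so
    that triangles of different sizes can be compared inside a common square. *)
Lemma sum_taylorD (R : comNzRingType) (a : nat -> R) (x y : R) N M :
  (N <= M)%N ->
  \sum_(n < N) a n * (x + y) ^+ n =
  \sum_(i < M) \sum_(j < M | (i + j < N)%N)
     a (i + j)%N * 'C(i + j, i)%:R * x ^+ i * y ^+ j.
Proof.
elim: N => [|N IH] NM.
  by rewrite big_ord0 big1 // => i _; rewrite big_pred0.
rewrite big_ord_recr /= IH ?(ltnW NM) //.
pose F i j := a (i + j)%N * 'C(i + j, i)%:R * x ^+ i * y ^+ j.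
have split_diag (i : 'I_M) : \sum_(j < M | (i + j < N.+1)%N) F i j =
    \sum_(j < M | (i + j < N)%N) F i j +
    (if (i < N.+1)%N then F i (N - i)%N else 0).
  rewrite (bigID (fun j : 'I_M => (i + j < N)%N)) /=; congr (_ + _).
    by apply: eq_bigl => j; rewrite andbC; case: ltnP => //= /ltnW.
  case: ltnP => [iN|Ni]; last by rewrite big_pred0 // => j; lia.
  have jM : (N - i < M)%N by lia.
  rewrite (big_pred1 (Ordinal jM)) // => j /=.
  by apply/idP/eqP => [ij|->]; [apply: val_inj => /=; lia | rewrite /=; lia].
rewrite [RHS](eq_bigr _ (fun i _ => split_diag i)) big_split /=; congr (_ + _).
rewrite -big_mkcond -(big_ord_widen _ (fun i => F i (N - i)%N)) //.
rewrite addrC exprDn mulr_sumr; apply: eq_bigr => i _.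
rewrite /F subnKC; last by rewrite -ltnS.
by rewrite -mulr_natr -!mulrA; congr (_ * _); rewrite mulrA mulrC [_ * x ^+ i]mulrC.
Qed.

(** The square of side [N] contains the triangle of size [N] and is contained
    in the triangle of size [2 N]; the terms between the two triangles add up to
    a piece of the series of absolute values. *)
Lemma square_truncation (R : realDomainType) (c : nat -> R) (x y : R) N :
  `|\sum_(i < N) \sum_(j < N)
      c (i + j)%N * 'C(i + j, i)%:R * x ^+ i * y ^+ j -
    \sum_(n < N) c n * (x + y) ^+ n| <=
  \sum_(N <= n < N + N) `|c n| * (`|x| + `|y|) ^+ n.
Proof.
pose G i j := `|c (i + j)%N| * 'C(i + j, i)%:R * `|x| ^+ i * `|y| ^+ j.
have G0 i j : 0 <= G i j by rewrite !mulr_ge0 // exprn_ge0.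
pose tri K M := \sum_(i < M) \sum_(j < M | (i + j < K)%N) G i j.
have triE K M : (K <= M)%N ->
    tri K M = \sum_(n < K) `|c n| * (`|x| + `|y|) ^+ n.
  by move=> KM; rewrite (sum_taylorD (fun n => `|c n|) _ _ KM).
have -> : \sum_(N <= n < N + N) `|c n| * (`|x| + `|y|) ^+ n =
    tri (N + N)%N (N + N)%N - tri N N.
  rewrite !triE // -!(big_mkord xpredT (fun n => `|c n| * (`|x| + `|y|) ^+ n)).
  by rewrite (big_cat_nat (leq0n N) (leq_addr N N)) /= addrAC subrr add0r.
rewrite (sum_taylorD c _ _ (leqnn N)) -sumrB.
apply: (@le_trans _ _ (\sum_(i < N) \sum_(j < N) G i j - tri N N)).
  rewrite /tri -sumrB; apply: le_trans (ler_norm_sum _ _ _) _.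
  apply: ler_sum => i _.
  rewrite (bigID (fun j : 'I_N => (i + j < N)%N)) /= addrAC subrr add0r.
  rewrite [X in X - _](bigID (fun j : 'I_N => (i + j < N)%N)) /= addrAC subrr add0r.
  apply: le_trans (ler_norm_sum _ _ _) _; apply: ler_sum => j _.
  by rewrite !normrM !normrX normr_nat.
rewrite lerD2r /tri.
rewrite (big_ord_widen _ (fun i => \sum_(j < N) G i j) (leq_addr N N)).
rewrite big_mkcond; apply: ler_sum => i _; case: ifP => iN; last by apply: sumr_ge0.
rewrite (big_ord_widen _ (G i) (leq_addr N N)) big_mkcond [leRHS]big_mkcond.
apply: ler_sum => j _; case: ifP => jN; last by case: ifP.
by rewrite ifT // -addnS leq_add // ltnW.
Qed.

(** * Linear recurrences and Hankel determinants *)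

(** Solves for the term of highest index.  The coefficients [g] depend only on
    [w], so that two sequences killed by [w] satisfy the very same recurrence. *)
Lemma recurrence_leading (F : fieldType) p (w : nat -> F) :
  (exists2 i, (i < p)%N & w i != 0) ->
  exists2 k, (k < p)%N & exists g : nat -> F, forall u : nat -> F,
    (forall n, \sum_(i < p) w i * u (n + i)%N = 0) ->
    forall n, u (n + k)%N = \sum_(i < k) g i * u (n + i)%N.
Proof.
move=> [i0 i0p wi0]; pose Q i := (i < p)%N && (w i != 0).
have exQ : exists i, Q i by exists i0; rewrite /Q i0p.
have ubQ i : Q i -> (i <= p)%N by case/andP => /ltnW.
case: (ex_maxnP exQ ubQ) => k /andP[kp wk] kmax; exists k => //.
exists (fun i => - (w k)^-1 * w i) => u Hu n.
apply: (mulfI wk); move: (Hu n).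
rewrite (bigID (fun i : 'I_p => (i < k.+1)%N)) /= [X in _ + X]big1 ?addr0; last first.
  move=> i; rewrite -leqNgt => ki; apply/eqP; rewrite mulf_eq0; apply/orP; left.
  by apply: contraTT ki => wi; rewrite -ltnNge ltnS kmax // /Q ltn_ord.
rewrite -(big_ord_widen _ (fun i => w i * u (n + i)%N)) // big_ord_recr /=.
move/eqP; rewrite addrC addr_eq0 => /eqP ->.
rewrite mulr_sumr -sumrN; apply: eq_bigr => i _.
by rewrite !mulrA mulrN mulfV // !mulNr mul1r.
Qed.

Lemma recurrence_uniq (F : fieldType) k (g u u' : nat -> F) :
  (forall n, u (n + k)%N = \sum_(i < k) g i * u (n + i)%N) ->
  (forall n, u' (n + k)%N = \sum_(i < k) g i * u' (n + i)%N) ->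
  (forall n, (n < k)%N -> u n = u' n) -> u =1 u'.
Proof.
move=> Hu Hu' init; elim/ltn_ind => n IH.
have [/init//|kn] := ltnP n k.
rewrite -(subnK kn) Hu Hu'; apply: eq_bigr => i _; rewrite IH //.
by rewrite -[ltnRHS](subnK kn) ltn_add2l.
Qed.

(** Shifts of a sequence satisfying a recurrence of order [k] lie in the span of
    the first [k] of them; this bounds the rank of its Hankel matrices. *)
Lemma recurrence_span (F : fieldType) k (g u : nat -> F) :
  (forall n, u (n + k)%N = \sum_(i < k) g i * u (n + i)%N) ->
  forall j, exists c : 'I_k -> F,
    forall n, u (n + j)%N = \sum_(l < k) u (n + l)%N * c l.
Proof.
move=> Hu; elim/ltn_ind => j IH.
have [jk|kj] := ltnP j k.
  exists (fun l => (l == Ordinal jk)%:R) => n.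
  rewrite (bigD1 (Ordinal jk)) //= eqxx mulr1 big1 ?addr0 // => l lj.
  by rewrite (negPf lj) mulr0.
have /fin_all_exists[c Hc] (i : 'I_k) : exists c : 'I_k -> F, forall n,
    u (n + (j - k + i))%N = \sum_(l < k) u (n + l)%N * c l.
  by apply: IH; rewrite -[ltnRHS](subnK kj) ltn_add2l.
exists (fun l => \sum_(i < k) g i * c i l) => n.
rewrite -(subnK kj) addnA Hu.
under eq_bigr do rewrite -addnA Hc mulr_sumr.
rewrite exchange_big /=; apply: eq_bigr => l _; rewrite mulr_sumr.
by apply: eq_bigr => i _; rewrite mulrCA.
Qed.

(** The matrix is [X * Hankel u * Y^T], and the Hankel matrix factors through
    dimension [k < p]. *)
Lemma det_recurrence_eq0 (F : fieldType) k p N (g u : nat -> F)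
    (X Y : 'I_p -> nat -> F) : (k < p)%N ->
  (forall n, u (n + k)%N = \sum_(i < k) g i * u (n + i)%N) ->
  \det (\matrix_(a < p, b < p)
          \sum_(i < N) \sum_(j < N) X a i * u (i + j)%N * Y b j) = 0.
Proof.
move=> kp Hu; set M := \matrix_(a, b) _.
have /fin_all_exists[c Hc] := fun j : 'I_N => recurrence_span Hu j.
pose A : 'M[F]_(p, k) := \matrix_(a, l) \sum_(i < N) X a i * u (i + l)%N.
pose B : 'M[F]_(k, p) := \matrix_(l, b) \sum_(j < N) c j l * Y b j.
have ME : M = A *m B.
  apply/matrixP => a b; rewrite !mxE.
  under [RHS]eq_bigr do rewrite !mxE mulr_suml.
  rewrite [RHS]exchange_big /=; apply: eq_bigr => i _.
  under [RHS]eq_bigr do rewrite mulr_sumr.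
  rewrite [RHS]exchange_big /=; apply: eq_bigr => j _.
  rewrite Hc mulr_sumr mulr_suml; apply: eq_bigr => l _.
  by rewrite !mulrA.
apply/eqP; apply: contraTT kp => detM; rewrite -leqNgt.
have <- : \rank M = p by rewrite mxrank_unit // unitmxE unitfE.
by rewrite ME mulmx_max_rank.
Qed.

(** * The flat limit of a kernel matrix *)

(** Entry [(i, j)] is the coefficient of [x ^ i * y ^ j] in the Taylor
    expansion of [f (x - y)]. *)
Definition wronskian_mx (R : realType) (f : R -> R) (p : nat) : 'M[R]_p :=
  \matrix_(i < p, j < p)
    (taylor_coef f (i + j) * 'C(i + j, i)%:R * (-1) ^+ j).

(** Column [j] holds the weights on the points [z] of the functional that
    extracts the coefficient of degree [j] of a polynomial of degree below
    [p]. *)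
Definition vander_dual (R : realType) (p : nat) (z : 'I_p -> R) : 'M[R]_p :=
  invmx (Vandermonde p (\row_a z a)).

Lemma Vandermonde_unit (R : realType) p (z : 'I_p -> R) : injective z ->
  Vandermonde p (\row_a z a) \in unitmx.
Proof.
move=> z_inj; rewrite unitmxE unitfE det_Vandermonde.
apply/prodf_neq0 => i _; apply/prodf_neq0 => j ij; rewrite !mxE subr_eq0.
by apply: contraTneq ij => /z_inj ->; rewrite ltnn.
Qed.

Lemma vander_dualE (R : realType) p (z : 'I_p -> R) (k : nat) (j : 'I_p) :
  injective z -> (k < p)%N ->
  \sum_a z a ^+ k * vander_dual z a j = (k == j)%:R.
Proof.
move=> z_inj kp.
have /matrixP/(_ (Ordinal kp) j) := mulmxV (Vandermonde_unit z_inj).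
by rewrite !mxE => <-; apply: eq_bigr => a _; rewrite !mxE.
Qed.

Lemma taylor_bilinear (R : comNzRingType) p (c : nat -> R) (z x y : 'I_p -> R)
    N e :
  \sum_a \sum_b x a * y b * (\sum_(n < N) c n * (e * (z a - z b)) ^+ n) =
  \sum_(k < N) \sum_(l < N | (k + l < N)%N)
     c (k + l)%N * 'C(k + l, k)%:R * (-1) ^+ l * e ^+ (k + l) *
     ((\sum_a z a ^+ k * x a) * (\sum_b z b ^+ l * y b)).
Proof.
pose T a b k l := c (k + l)%N * 'C(k + l, k)%:R * (-1) ^+ l * e ^+ (k + l) *
  ((z a ^+ k * x a) * (z b ^+ l * y b)).
transitivity (\sum_a \sum_b \sum_(k < N) \sum_(l < N | (k + l < N)%N) T a b k l).
  apply: eq_bigr => a _; apply: eq_bigr => b _.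
  rewrite mulrBr (sum_taylorD c _ _ (leqnn N)) mulr_sumr.
  apply: eq_bigr => k _; rewrite mulr_sumr; apply: eq_bigr => l _.
  by rewrite /T -[- (e * z b)]mulN1r !exprMn exprD; ring.
under eq_bigr do rewrite exchange_big /=.
rewrite exchange_big /=; apply: eq_bigr => k _.
under eq_bigr do rewrite exchange_big /=.
rewrite exchange_big /=; apply: eq_bigr => l _.
by rewrite big_distrlr mulr_sumr; apply: eq_bigr => a _; rewrite mulr_sumr.
Qed.

(** In the double expansion, the term of degrees [(k, l)] is multiplied by
    [e ^ (k + l)] and by the moments of the dual functionals [i] and [j].  A
    moment of degree below [p] vanishes unless it has the matching degree, so
    apart from [(i, j)] only terms with [k + l > i + j] survive. *)
Lemma flat_limit_entry (R : realType) (f : R -> R) p (z : 'I_p -> R) :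
  analytic_near0 f ->
  (forall k, odd k -> (k < (2 * p).-1)%N -> taylor_coef f k = 0) ->
  injective z -> forall i j : 'I_p,
  bigO_pow 1 (fun e =>
    (\sum_a \sum_b vander_dual z a i * vander_dual z b j *
       f (e * `|z a - z b|)) / e ^+ (i + j) - wronskian_mx f p i j).
Proof.
move=> f_an odd0 z_inj i j; set D := vander_dual z; set W := wronskian_mx f p.
pose N := (2 * p).-1; set c := taylor_coef f.
have ijN : ((i + j).+1 <= N)%N by have := ltn_ord i; have := ltn_ord j; lia.
suff H : bigO_pow (i + j).+1 (fun e =>
    \sum_a \sum_b D a i * D b j * f (e * `|z a - z b|) - W i j * e ^+ (i + j)).
  have := bigO_pow_div (leqnSn (i + j)) H; rewrite subSnn.
  apply: bigO_pow_ext => e e0; rewrite mulrBl mulfK // gt_eqF //.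
  by rewrite exprn_gt0.
have Hrem : bigO_pow (i + j).+1 (fun e => \sum_a \sum_b D a i * D b j *
    (f (e * `|z a - z b|) - \sum_(n < N) c n * (e * (z a - z b)) ^+ n)).
  apply: bigO_pow_sum => a _; apply: bigO_pow_sum => b _; apply: bigO_powMl.
  apply: bigO_powW ijN _.
  have Oab : bigO_pow 1 (fun e : R => e * `|z a - z b|).
    apply: bigO_pow_ext (bigO_powMl `|z a - z b| (bigO_powXn R 1)) => e _.
    by rewrite expr1 mulrC.
  apply: bigO_pow_ext (bigO_pow_taylor N f_an Oab) => e _.
  congr (_ - _); apply: eq_bigr => n _.
  have [on|en] := boolP (odd n); first by rewrite /c odd0 ?mul0r.
  rewrite !exprMn; congr (_ * (_ * _)).
  by rewrite -normrX ger0_norm // exprn_even_ge0.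
have Hpol : bigO_pow (i + j).+1 (fun e => \sum_a \sum_b D a i * D b j *
    (\sum_(n < N) c n * (e * (z a - z b)) ^+ n) - W i j * e ^+ (i + j)).
  have iN : (i < N)%N by lia.
  have jN : (j < N)%N by lia.
  pose mu k (l : 'I_p) := \sum_a z a ^+ k * D a l.
  pose t k l e := c (k + l)%N * 'C(k + l, k)%:R * (-1) ^+ l * e ^+ (k + l) *
     (mu k i * mu l j).
  have tO k l : ~~ ((k == i :> nat) && (l == j :> nat)) ->
      bigO_pow (i + j).+1 (t k l).
    move=> kl; have [ij|ij] := ltnP (i + j) (k + l).
      apply: bigO_powW ij _.
      apply: bigO_pow_ext (bigO_powMl (c (k + l)%N * 'C(k + l, k)%:R *
        (-1) ^+ l * (mu k i * mu l j)) (bigO_powXn R (k + l))) => e _.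
      by rewrite /t; ring.
    apply: bigO_pow_ext (bigO_pow0 R _) => e _.
    suff : mu k i * mu l j = 0 by rewrite /t => ->; rewrite mulr0.
    have [/andP[kp ki]|ki] := boolP ((k < p)%N && (k != i)).
      by rewrite /mu vander_dualE // (negPf ki) mul0r.
    have [/andP[lp lj]|lj] := boolP ((l < p)%N && (l != j)).
      by rewrite /mu [X in _ * X]vander_dualE // (negPf lj) mulr0.
    by have := ltn_ord i; have := ltn_ord j; lia.
  have Oi : bigO_pow (i + j).+1 (fun e =>
      \sum_(l < N | (i + l < N)%N && (l != Ordinal jN)) t i l e).
    apply: bigO_pow_sum => l /andP[_ lj]; apply: tO.
    by apply: contra lj => /andP[_ lj]; apply/eqP/val_inj/eqP.
  have Ok : bigO_pow (i + j).+1 (fun e => \sum_(k < N | k != Ordinal iN)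
      \sum_(l < N | (k + l < N)%N) t k l e).
    apply: bigO_pow_sum => k ki; apply: bigO_pow_sum => l _; apply: tO.
    by apply: contra ki => /andP[ki _]; apply/eqP/val_inj/eqP.
  apply: bigO_pow_ext (bigO_powD Oi Ok) => e _.
  rewrite taylor_bilinear [RHS]addrC.
  rewrite [in RHS](bigD1 (Ordinal iN)) //= [in RHS](bigD1 (Ordinal jN)) //=.
  rewrite -[X in _ = _ + (X + _ + _)]/(t i j e).
  have -> : t i j e = W i j * e ^+ (i + j).
    by rewrite /t /mu !vander_dualE // !eqxx !mulr1 /W mxE.
  by rewrite -addrA addKr.
apply: bigO_pow_ext (bigO_powD Hrem Hpol) => e _.
rewrite addrA; congr (_ - _); rewrite -big_split; apply: eq_bigr => a _ /=.
rewrite -big_split; apply: eq_bigr => b _ /=.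
by rewrite -mulrDr subrK.
Qed.

Lemma cvg_det (R : realType) (T : Type) (F : set_system T) {FF : Filter F}
    p (A : T -> 'M[R]_p) (B : 'M[R]_p) :
  (forall i j, A t i j @[t --> F] --> B i j) ->
  \det (A t) @[t --> F] --> \det B.
Proof.
move=> AB; rewrite /determinant.
apply: cvg_big => [|s _]; first exact: add_continuous.
apply: cvgM; first exact: cvg_cst.
by apply: cvg_big => [|i _]; [exact: mul_continuous | exact: AB].
Qed.

(** The powers of [e] enter only through a factor common to all sets of [p]
    points, which cancels in ratios of minors. *)
Lemma flat_limit_det (R : realType) (f : R -> R) p (z : 'I_p -> R) :
  analytic_near0 f ->
  (forall k, odd k -> (k < (2 * p).-1)%N -> taylor_coef f k = 0) ->
  injective z ->
  (\prod_(i < p) (e ^+ i)^-1) ^+ 2 *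
    \det (\matrix_(a < p, b < p) f (e * `|z a - z b|)) @[e --> 0^'+] -->
  \det (wronskian_mx f p) * \det (Vandermonde p (\row_a z a)) ^+ 2.
Proof.
move=> f_an odd0 z_inj; set U := Vandermonde p _.
have detU : \det U != 0 by have := Vandermonde_unit z_inj; rewrite unitmxE unitfE.
set D := vander_dual z.
have detD : \det D = (\det U)^-1 by rewrite det_inv.
pose K e : 'M[R]_p := \matrix_(a, b) f (e * `|z a - z b|).
pose d e : 'M[R]_p := diag_mx (\row_i (e ^+ i)^-1).
pose Q e := d e *m (D^T *m K e *m D) *m d e.
have QE e i j : Q e i j =
    (\sum_a \sum_b D a i * D b j * f (e * `|z a - z b|)) / e ^+ (i + j).
  rewrite /Q mul_diag_mx mul_mx_diag !mxE exprD invfM.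
  rewrite mulrAC mulrC; congr (_ * _).
  under eq_bigr do rewrite mxE mulr_suml.
  rewrite [LHS]exchange_big /=; apply: eq_bigr => a _; apply: eq_bigr => b _.
  by rewrite !mxE; ring.
have detQ : \det (Q e) @[e --> 0^'+] --> \det (wronskian_mx f p).
  apply: cvg_det => i j; under eq_cvg do rewrite QE.
  exact: bigO_pow1_cvg (flat_limit_entry f_an odd0 z_inj i j).
apply: cvg_trans _ (cvgM detQ (cvg_cst (\det U ^+ 2))).
apply: near_eq_cvg; near=> e => /=.
rewrite !det_mulmx det_tr detD det_diag.
under eq_bigr do rewrite mxE.
by field.
Unshelve. all: by end_near. Qed.

(** * Functionals that become null in the flat limit *)

Lemma kernel_form_gt0 (R : realType) (kappa : R -> R -> R) (f : R -> R) p
    (z c : 'I_p -> R) (i : 'I_p) :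
  is_kernel kappa -> is_stationary kappa f -> injective z -> c i != 0 ->
  0 < \sum_a \sum_b c a * c b * f `|z a - z b|.
Proof.
move=> ker stat z_inj ci; have [_ pos] := ker _ _ z_inj.
have /pos : \col_a c a != 0.
  by apply: contraNneq ci => /colP/(_ i); rewrite !mxE => ->.
rewrite mxE; under eq_bigr do rewrite mxE mulr_suml.
rewrite exchange_big /=; congr (_ < _); apply: eq_bigr => a _.
by apply: eq_bigr => b _; rewrite !mxE stat mulrAC.
Qed.

(** Positivity of the form on the points [z] together with [y], where [y] has
    weight [s]; the choice [s = - beta / f 0] minimizes the form. *)
Lemma kernel_cauchy_schwarz (R : realType) (kappa : R -> R -> R) (f : R -> R) p
    (z c : 'I_p -> R) (y : R) :
  is_kernel kappa -> is_stationary kappa f -> injective z ->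
  (forall a, z a != y) ->
  (\sum_a c a * f `|z a - y|) ^+ 2 <=
  (\sum_a \sum_b c a * c b * f `|z a - z b|) * f 0.
Proof.
move=> ker stat z_inj zy; set beta := \sum_a c a * _; set alpha := \sum_a \sum_b _.
have f0 : 0 < f 0.
  have := @kernel_form_gt0 R kappa f 1 (fun=> 0) (fun=> 1) ord0 ker stat.
  rewrite !big_ord1 subrr normr0 !mul1r; apply; last exact: oner_neq0.
  by move=> a b _; rewrite !ord1.
have pos s : s != 0 -> 0 < s ^+ 2 * f 0 + 2 * s * beta + alpha.
  move=> s0.
  pose z' (i : 'I_p.+1) := if unlift ord0 i is Some a then z a else y.
  pose c' (i : 'I_p.+1) := if unlift ord0 i is Some a then c a else s.
  have z'_inj : injective z'.
    move=> i j; rewrite /z'.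
    case: unliftP => [a ->|->]; case: unliftP => [b ->|->] //.
    - by move=> /z_inj ->.
    - by move=> za; have := zy a; rewrite za eqxx.
    - by move=> zb; have := zy b; rewrite -zb eqxx.
  suff -> : s ^+ 2 * f 0 + 2 * s * beta + alpha =
      \sum_a \sum_b c' a * c' b * f `|z' a - z' b|.
    by apply: (kernel_form_gt0 (i := ord0) ker stat z'_inj); rewrite /c' unlift_none.
  rewrite [RHS]big_ord_recl [X in _ = X + _]big_ord_recl.
  rewrite /z' /c' unlift_none subrr normr0.
  under [X in _ = _ + X + _]eq_bigr do rewrite liftK -mulrA distrC.
  rewrite -mulr_sumr -/beta.
  under [X in _ = _ + X]eq_bigr do rewrite liftK big_ord_recl unlift_none.
  rewrite big_split /=.
  under [X in _ = _ + (X + _)]eq_bigr do rewrite [c _ * s]mulrC -mulrA.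
  rewrite -mulr_sumr -/beta.
  under [X in _ = _ + (_ + X)]eq_bigr do under eq_bigr do rewrite liftK.
  rewrite -/alpha expr2. ring.
have [->|b0] := eqVneq beta 0.
  rewrite expr0n /= mulr_ge0 ?(ltW f0) //.
  have [i ci|c0] := pickP (fun i => c i != 0).
    exact: ltW (kernel_form_gt0 ker stat z_inj ci).
  rewrite /alpha big1 // => a _; rewrite big1 // => b _.
  by move/negbFE/eqP: (c0 a) => ->; rewrite !mul0r.
have : - (beta / f 0) != 0 by rewrite oppr_eq0 mulf_neq0 // invr_neq0 // gt_eqF.
move=> /pos.
have -> : (- (beta / f 0)) ^+ 2 * f 0 + 2 * - (beta / f 0) * beta + alpha =
    alpha - beta ^+ 2 / f 0 by field; rewrite gt_eqF.
by rewrite subr_gt0 ltr_pdivrMr // => /ltW.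
Qed.

(** By the flat limit of the entries the energy is [v W v^T + O(e)], and
    [v W = 0]. *)
Lemma flat_null_energy (R : realType) (f : R -> R) p (z : 'I_p -> R)
    (v : 'rV[R]_p) :
  analytic_near0 f ->
  (forall k, odd k -> (k < (2 * p).-1)%N -> taylor_coef f k = 0) ->
  injective z -> v *m wronskian_mx f p = 0 ->
  bigO_pow 1 (fun e => \sum_a \sum_b
    (\sum_i v 0 i * vander_dual z a i / e ^+ i) *
    (\sum_j v 0 j * vander_dual z b j / e ^+ j) * f `|e * z a - e * z b|).
Proof.
move=> f_an odd0 z_inj vW0; set D := vander_dual z.
pose Q i j e := (\sum_a \sum_b D a i * D b j * f (e * `|z a - z b|)) / e ^+ (i + j).
have H : bigO_pow 1 (fun e => \sum_i \sum_j v 0 i * v 0 j *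
    (Q i j e - wronskian_mx f p i j)).
  apply: bigO_pow_sum => i _; apply: bigO_pow_sum => j _.
  apply: bigO_powMl; exact: flat_limit_entry.
apply: bigO_pow_ext H => e e0.
have -> : \sum_i \sum_j v 0 i * v 0 j * (Q i j e - wronskian_mx f p i j) =
    \sum_i \sum_j v 0 i * v 0 j * Q i j e.
  apply/eqP; rewrite -subr_eq0 -sumrB; apply/eqP.
  transitivity (- \sum_j v 0 j * (v *m wronskian_mx f p) 0 j).
    rewrite -sumrN; under [RHS]eq_bigr do rewrite mxE mulr_sumr -sumrN.
    rewrite exchange_big /=; apply: eq_bigr => i _; rewrite -sumrB.
    by apply: eq_bigr => j _; ring.
  by rewrite vW0 big1 ?oppr0 // => j _; rewrite mxE mulr0.
pose T a b (i j : 'I_p) := (v 0 i * D a i / e ^+ i) * (v 0 j * D b j / e ^+ j) *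
  f `|e * z a - e * z b|.
transitivity (\sum_i \sum_j \sum_a \sum_b T a b i j).
  apply: eq_bigr => i _; apply: eq_bigr => j _.
  rewrite /Q mulr_suml mulr_sumr; apply: eq_bigr => a _.
  rewrite mulr_suml mulr_sumr; apply: eq_bigr => b _.
  rewrite /T -mulrBr normrM (gtr0_norm e0) exprD invfM; ring.
under eq_bigr do rewrite exchange_big /=.
rewrite exchange_big /=; apply: eq_bigr => a _.
under eq_bigr do rewrite exchange_big /=.
rewrite exchange_big /=; apply: eq_bigr => b _.
rewrite big_distrlr /= mulr_suml; apply: eq_bigr => i _.
by rewrite mulr_suml.
Qed.

(** The cluster lives at scale [e ^ S] and is tested against the point
    [- s * e].  By the Cauchy-Schwarz inequality the test value is
    [O(e ^ (S / 2))].  On the other hand it is, up to higher order, a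
    polynomial in [e] whose coefficient of degree [n] is the sum to be shown
    zero; taking [S = 2 (n + 1)] makes this coefficient visible. *)
Lemma flat_null_recurrence (R : realType) (kappa : R -> R -> R) (f : R -> R)
    p (v : 'rV[R]_p) (s : R) :
  is_kernel kappa -> is_stationary kappa f -> analytic_near0 f ->
  (forall k, odd k -> (k < (2 * p).-1)%N -> taylor_coef f k = 0) ->
  v *m wronskian_mx f p = 0 -> `|s| = 1 ->
  forall n, \sum_(i < p)
    taylor_coef f (n + i) * 'C(n + i, n)%:R * s ^+ i * v 0 i = 0.
Proof.
move=> ker stat f_an odd0 vW0 s1 n; set c := taylor_coef f.
have ss : s * s = 1 by rewrite -expr2 -real_normK ?num_real // s1 expr1n.
pose z (a : 'I_p) : R := a%:R.
have z_inj : injective z by move=> a b /eqP; rewrite eqr_nat => /eqP/val_inj.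
set D := vander_dual z.
pose w e a := \sum_i v 0 i * D a i / e ^+ i.
(* The truncation order [N] leaves a remainder [O(e ^ (n + 1))] even after
   multiplication by the weights, which are at worst of order
   [e ^ - (S * (p - 1))]. *)
pose S := (2 * n.+1)%N; pose N := (S * p + n.+1)%N.
pose h (a : 'I_p) e := e + s * e ^+ S * z a.
pose beta e := \sum_a w (e ^+ S) a * f (h a e).
have SE e : e ^+ S = e * e ^+ S.-1 by rewrite -exprS.
have S1 : (1 <= S.-1)%N by rewrite /S; lia.
have Obeta : bigO_pow n.+1 beta.
  apply: bigO_pow_sqr; rewrite -/S.
  have S0 : (0 < S)%N by [].
  have := bigO_powMl (f 0) (bigO_pow_comp S0 (flat_null_energy f_an odd0 z_inj vW0)).
  rewrite muln1 => -[C [d [C0 d0 d1 H]]].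
  have p0 : 0 < p%:R + 1 :> R by rewrite ltr_wpDl.
  apply: (@bigO_powI _ _ _ C (Num.min d (p%:R + 1)^-1)).
    by rewrite lt_min d0 invr_gt0.
  move=> e /andP[e0]; rewrite lt_min => /andP[ed ep].
  have {}ep : e * p%:R + e < 1.
    by move: ep; rewrite -[ltRHS]mul1r ltr_pdivlMr // mulrDr mulr1.
  (* The cluster lies within [e] of the origin, so the test point is outside
     it, and the distances are [e + s * e ^ S * z a] without absolute value. *)
  have za a : 0 <= e ^+ S * z a < e.
    have zp : z a <= p%:R by rewrite ler_nat ltnW.
    have z0 : 0 <= z a by rewrite /z.
    have es1 : e ^+ S.-1 <= e.
      rewrite -[leRHS]expr1 ler_wiXn2l ?(ltW e0) ?S1 //.
      have : 0 <= e * p%:R by rewrite mulr_ge0 // ltW.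
      by lra.
    apply/andP; split; first by rewrite mulr_ge0 ?exprn_ge0 ?(ltW e0).
    rewrite SE -mulrA gtr_pMr //.
    apply: le_lt_trans (_ : e * p%:R < 1); last by lra.
    by rewrite ler_pM // exprn_ge0 // ltW.
  have hE a : `|e ^+ S * z a - (- (s * e))| = h a e.
    rewrite opprK; have -> : e ^+ S * z a + s * e = s * h a e.
      by rewrite /h mulrDr !mulrA ss mul1r addrC.
    rewrite normrM s1 mul1r ger0_norm // /h -mulrA.
    have /andP[l1 l2] := za a; have := ler_norm (- (s * (e ^+ S * z a))).
    rewrite normrN normrM s1 mul1r ger0_norm //; lra.
  have E0 : 0 < e ^+ S by rewrite exprn_gt0.
  have -> : beta e = \sum_a w (e ^+ S) a * f `|e ^+ S * z a - (- (s * e))|.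
    by apply: eq_bigr => a _; rewrite hE.
  apply: le_trans (H e _); last by rewrite e0.
  rewrite [X in _ <= `|X|]mulrC; apply: le_trans (ler_norm _).
  rewrite ger0_norm ?sqr_ge0 //.
  apply: (kernel_cauchy_schwarz (z := fun a => e ^+ S * z a) _ ker stat).
    by move=> a b /(mulfI (lt0r_neq0 E0))/z_inj.
  move=> a; rewrite -subr_eq0 -normr_gt0 hE /h -mulrA.
  have /andP[l1 l2] := za a; have := ler_norm (- (s * (e ^+ S * z a))).
  rewrite normrN normrM s1 mul1r ger0_norm //; lra.
have Orem : bigO_pow n.+1 (fun e => \sum_a w (e ^+ S) a *
    (f (h a e) - \sum_(k < N) c k * h a e ^+ k)).
  apply: bigO_pow_sum => a _.
  have Oh : bigO_pow 1 (h a).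
    apply: bigO_pow_ext (bigO_powD (bigO_powXn R 1)
      (bigO_powMl (s * z a) (bigO_powW (isT : (1 <= S)%N) (bigO_powXn R S)))).
    by move=> e _; rewrite /h expr1; ring.
  have H i : bigO_pow n.+1 (fun e => v 0 i * D a i *
      ((f (h a e) - \sum_(k < N) c k * h a e ^+ k) / e ^+ (S * i))).
    apply: bigO_powMl; have SiN : (S * i + n.+1 <= N)%N.
      by rewrite leq_add2r leq_mul2l ltnW ?orbT.
    have SiN' : (S * i <= N)%N by exact: leq_trans (leq_addr _ _) SiN.
    apply: bigO_powW (bigO_pow_div SiN' (bigO_pow_taylor N f_an Oh)).
    by rewrite leq_subRL.
  apply: bigO_pow_ext (bigO_pow_sum _ (fun i _ => H i)) => e _.
  by rewrite mulr_suml; apply: eq_bigr => i _; rewrite exprM; ring.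
(* [M l e] is the rescaled moment of degree [l] of the cluster, [m l] its limit. *)
pose m (l : nat) := \sum_(i < p) v 0 i * (l == i)%:R.
pose b k := \sum_(l < N | (k + l < N)%N) c (k + l)%N * 'C(k + l, k)%:R * s ^+ l * m l.
pose M l e := \sum_(i < p) v 0 i *
  ((\sum_a z a ^+ l * D a i) * (e ^+ (S * l) / e ^+ (S * i))).
have OM l : bigO_pow n.+1 (fun e => M l e - m l).
  have H (i : 'I_p) : bigO_pow n.+1 (fun e => v 0 i *
      ((\sum_a z a ^+ l * D a i) * (e ^+ (S * l) / e ^+ (S * i)) - (l == i)%:R)).
    apply: bigO_powMl; have [lp|pl] := ltnP l p.
      apply: bigO_pow_ext (bigO_pow0 R _) => e e0.
      rewrite vander_dualE //; case: eqVneq => [->|_]; last by rewrite mul0r subr0.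
      by rewrite mul1r mulfV ?subrr // gt_eqF // exprn_gt0.
    have il : (i < l)%N by apply: leq_trans pl.
    have Sil : (S * i + S <= S * l)%N by rewrite addnC -mulnS leq_mul2l il orbT.
    rewrite (gtn_eqF il); set K := \sum_a _.
    have Sil' : (S * i <= S * l)%N by rewrite leq_mul2l (ltnW il) orbT.
    have H := bigO_powMl K (bigO_pow_div Sil' (bigO_powXn R (S * l)%N)).
    apply: bigO_pow_ext (bigO_powW _ H) => [e _|]; first by rewrite subr0.
    rewrite leq_subRL //; apply: leq_trans Sil; rewrite leq_add2l.
    by rewrite /S leq_pmull.
  apply: bigO_pow_ext (bigO_pow_sum _ (fun i _ => H i)) => e _.
  by rewrite /M /m -sumrB; apply: eq_bigr => i _; rewrite mulrBr.
have Opol : bigO_pow n.+1 (fun e =>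
    \sum_a w (e ^+ S) a * (\sum_(k < N) c k * h a e ^+ k) -
    \sum_(k < N) b k * e ^+ k).
  have H : bigO_pow n.+1 (fun e => \sum_(k < N) \sum_(l < N | (k + l < N)%N)
      c (k + l)%N * 'C(k + l, k)%:R * s ^+ l * (e ^+ k * (M l e - m l))).
    apply: bigO_pow_sum => k _; apply: bigO_pow_sum => l _; apply: bigO_powMl.
    by apply: bigO_powW (bigO_powM (bigO_powXn R k) (OM l)); rewrite leq_addl.
  apply: bigO_pow_ext H => e e0.
  pose T (a : 'I_p) (k l : 'I_N) := c (k + l)%N * 'C(k + l, k)%:R * s ^+ l * e ^+ k *
    (w (e ^+ S) a * (z a ^+ l * e ^+ (S * l))).
  have -> : \sum_a w (e ^+ S) a * (\sum_(k < N) c k * h a e ^+ k) =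
     \sum_a \sum_(k < N) \sum_(l < N | (k + l < N)%N) T a k l.
    apply: eq_bigr => a _; rewrite (sum_taylorD c _ _ (leqnn N)) mulr_sumr.
    apply: eq_bigr => k _; rewrite mulr_sumr; apply: eq_bigr => l _.
    by rewrite /T !exprMn exprM; ring.
  rewrite exchange_big -sumrB; apply: eq_bigr => k _ /=.
  rewrite exchange_big /b mulr_suml -sumrB; apply: eq_bigr => l _ /=.
  rewrite /T -mulr_sumr.
  have -> : M l e = \sum_a w (e ^+ S) a * (z a ^+ l * e ^+ (S * l)).
    rewrite /M; under [RHS]eq_bigr do rewrite mulr_suml.
    rewrite [RHS]exchange_big; apply: eq_bigr => i _ /=.
    rewrite mulr_suml mulr_sumr; apply: eq_bigr => a _.
    by rewrite -exprM; ring.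
  ring.
have : bigO_pow n.+1 (fun e => \sum_(k < N) b k * e ^+ k).
  apply: bigO_pow_ext (bigO_powB (bigO_powB Obeta Orem) Opol) => e _.
  rewrite /beta -sumrB opprB addrCA -sumrB [X in _ + X]big1 ?addr0 // => a _.
  by rewrite -mulrBr; ring.
have nN : (n < N)%N by rewrite /N; lia.
move=> /bigO_pow_poly_eq0/(_ n nN (ltnSn n)) bn0; rewrite -[RHS]bn0.
rewrite /b /m; under [RHS]eq_bigr do rewrite mulr_sumr.
rewrite [RHS]exchange_big /=. apply: eq_bigr => i _.
have niN : (n + i < N)%N by have := ltn_ord i; rewrite /N /S; nia.
have iN : (i < N)%N by lia.
rewrite (bigD1 (Ordinal iN)) //= eqxx mulr1 big1 ?addr0 //.
move=> l /andP[_ li]; case: eqVneq => [E|_]; last by rewrite !mulr0.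
by case/negP: li; apply/eqP/val_inj.
Qed.

(** * Nondegeneracy of the limit matrix *)

(** The recurrences for [s = 1] and [s = -1] say that the derivatives [u n] of
    [f] at [0] and the sequence [(-1) ^ n * u n] are killed by the same weights;
    they agree on the first [p - 1] indices by hypothesis on the odd
    coefficients, hence everywhere. *)
Lemma flat_null_odd_eq0 (R : realType) (kappa : R -> R -> R) (f : R -> R)
    p (v : 'rV[R]_p) :
  is_kernel kappa -> is_stationary kappa f -> analytic_near0 f ->
  (forall k, odd k -> (k < (2 * p).-1)%N -> taylor_coef f k = 0) ->
  v != 0 -> v *m wronskian_mx f p = 0 ->
  (forall n, odd n -> taylor_coef f n = 0) /\
  exists2 k, (k < p)%N & exists g : nat -> R, forall n,
    taylor_coef f (n + k) * (n + k)`!%:R =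
    \sum_(i < k) g i * (taylor_coef f (n + i) * (n + i)`!%:R).
Proof.
move=> ker stat f_an odd0 v0 vW0; set c := taylor_coef f.
have fact0 n : n`!%:R != 0 :> R by rewrite pnatr_eq0 -lt0n fact_gt0.
pose u n := c n * n`!%:R.
pose w n := oapp (v 0) 0 (insub n) / n`!%:R.
have wE (i : 'I_p) : w i = v 0 i / i`!%:R by rewrite /w valK.
have Hs (s : R) : `|s| = 1 -> forall n, \sum_(i < p) w i * (s ^+ i * u (n + i)%N) = 0.
  move=> s1 n.
  have H := flat_null_recurrence ker stat f_an odd0 vW0 s1 n.
  transitivity (n`!%:R * \sum_(i < p)
      c (n + i)%N * 'C(n + i, n)%:R * s ^+ i * v 0 i); last by rewrite H mulr0.
  rewrite mulr_sumr; apply: eq_bigr => i _.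
  rewrite wE /u -(bin_fact (leq_addr i n)) addKn !natrM.
  by field; rewrite fact0.
have [k kp [g Hg]] : exists2 k, (k < p)%N & exists g : nat -> R, forall u,
    (forall n, \sum_(i < p) w i * u (n + i)%N = 0) ->
    forall n, u (n + k)%N = \sum_(i < k) g i * u (n + i)%N.
  apply: recurrence_leading.
  have /rV0Pn[i vi] := v0; exists i => //.
  by rewrite wE mulf_neq0 // invr_eq0.
have Hu := Hg u.
have {}Hu n : u (n + k)%N = \sum_(i < k) g i * u (n + i)%N.
  apply: Hg => {}n; rewrite -[RHS](Hs 1 (normr1 _) n).
  by apply: eq_bigr => i _; rewrite expr1n mul1r.
pose u' n := (-1) ^+ n * u n.
have Hu' n : u' (n + k)%N = \sum_(i < k) g i * u' (n + i)%N.
  apply: Hg => {}n.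
  transitivity ((-1) ^+ n * \sum_(i < p) w i * ((-1) ^+ i * u (n + i)%N)).
    rewrite mulr_sumr; apply: eq_bigr => i _.
    by rewrite /u' exprD; ring.
  by rewrite Hs ?mulr0 ?normrN1.
have uu' : u =1 u'.
  apply: recurrence_uniq Hu Hu' _ => n nk; rewrite /u'.
  have [on|en] := boolP (odd n); last by rewrite -signr_odd (negPf en) mul1r.
  by rewrite /u /c odd0 ?mul0r ?mulr0 //; lia.
split; last by exists k => //; exists g.
move=> n on; have := uu' n; rewrite /u' -signr_odd on expr1 mulN1r.
move=> /eqP; rewrite -addr_eq0 -mulr2n mulrn_eq0 /= mulf_eq0 (negPf (fact0 n)).
by rewrite orbF => /eqP.
Qed.

(** Otherwise [f] is even near [0] and its derivatives at [0] satisfy a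
    recurrence of order below [p], so the kernel matrix of [p] points close to
    [0] is singular, against strict positive definiteness. *)
Lemma wronskian_det_neq0 (R : realType) (kappa : R -> R -> R) (f : R -> R) p :
  is_kernel kappa -> is_stationary kappa f -> analytic_near0 f ->
  (forall k, odd k -> (k < (2 * p).-1)%N -> taylor_coef f k = 0) ->
  \det (wronskian_mx f p) != 0.
Proof.
move=> ker stat f_an odd0; apply/negP => /det0P[v v0 vW0].
have [all_odd0 [k kp [g Hg]]] := flat_null_odd_eq0 ker stat f_an odd0 v0 vW0.
have [B [q [B0 q0 tail lim rem]]] := analytic_tail f_an.
set c := taylor_coef f in all_odd0 Hg tail lim rem.
(* Points [x a] with [q * (|x a| + |x b|) <= 1/2], so that the double series
   of [f (x a - x b)] in [x a] and [- x b] converges absolutely. *)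
pose eta := (4 * q * (p%:R + 1))^-1.
have p1 : 0 < p%:R + 1 :> R by rewrite ltr_wpDl.
have eta0 : 0 < eta by rewrite invr_gt0 !mulr_gt0.
pose x (a : 'I_p) : R := a%:R * eta.
have xle a : q * `|x a| <= 4^-1.
  rewrite ger0_norm; last by rewrite mulr_ge0 // ltW.
  have -> : 4^-1 = q * ((p%:R + 1) * eta).
    by rewrite /eta; field; rewrite !gt_eqF.
  rewrite ler_pM2l // ler_pM2r // natr1 ler_nat.
  by rewrite ltnW // ltnS ltnW.
have xyle a b : q * (`|x a| + `|x b|) <= 2^-1.
  by have := xle a; have := xle b; lra.
have dle a b : q * `|x a - x b| <= 2^-1.
  by apply: le_trans (xyle a b); rewrite ler_pM2l // ler_normB.
have even_f t : q * `|t| <= 2^-1 -> f `|t| = f t.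
  move=> ht; have := lim `|t|; rewrite normr_id => /(_ ht).
  rewrite (_ : [series c n * `|t| ^+ n]_n = [series c n * t ^+ n]_n).
    by move=> lim_abs; exact: (cvg_unique (@Rhausdorff R) lim_abs (lim t ht)).
  congr series; apply/funext => n /=.
  have [on|en] := boolP (odd n); first by rewrite all_odd0 ?mul0r.
  by rewrite -normrX ger0_norm // exprn_even_ge0.
(* [M N] truncates the double series to a square: [X * Hankel * Y^T]. *)
pose M N : 'M[R]_p := \matrix_(a, b) \sum_(i < N) \sum_(j < N)
  (x a ^+ i / i`!%:R) * (c (i + j)%N * (i + j)`!%:R) * ((- x b) ^+ j / j`!%:R).
pose K : 'M[R]_p := \matrix_(a, b) f (x a - x b).
have MK a b : M N a b @[N --> \oo] --> K a b.
  have H : (B * 2^-1 ^+ N + B * 2^-1 ^+ N) @[N --> \oo] --> (0 : R).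
    rewrite -[X in _ --> X](addr0 0) -(mulr0 B).
    have G : (2^-1 : R) ^+ N @[N --> \oo] --> (0 : R).
      by apply: cvg_expr; rewrite gtr0_norm //; lra.
    by apply: cvgD; apply: cvgMr.
  apply/cvgrPdist_le => e e0.
  have /cvgrPdist_le/(_ e e0) := H; apply: filterS => N.
  rewrite sub0r normrN ger0_norm; last by rewrite addr_ge0 // mulr_ge0 // exprn_ge0.
  apply: le_trans; rewrite !mxE.
  have -> : \sum_(i < N) \sum_(j < N) (x a ^+ i / i`!%:R) *
      (c (i + j)%N * (i + j)`!%:R) * ((- x b) ^+ j / j`!%:R) =
      \sum_(i < N) \sum_(j < N) c (i + j)%N * 'C(i + j, i)%:R * x a ^+ i * (- x b) ^+ j.
    apply: eq_bigr => i _; apply: eq_bigr => j _.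
    rewrite -(bin_fact (leq_addr j i)) addKn !natrM.
    by field; rewrite !pnatr_eq0 -!lt0n !fact_gt0.
  rewrite -(subrK (\sum_(n < N) c n * (x a - x b) ^+ n) (f _)) -addrA.
  apply: le_trans (ler_normD _ _) _; apply: lerD.
    apply: le_trans (rem _ N (dle a b)) _; rewrite ler_wpM2l //.
    by apply: lerXn2r; rewrite ?nnegrE ?mulr_ge0 // ?invr_ge0 // ltW.
  rewrite distrC; apply: le_trans (square_truncation _ _ _ _) _; rewrite normrN.
  apply: le_trans (tail _ _ _ _ (xyle a b)) _; first by rewrite addr_ge0.
  rewrite ler_wpM2l //; apply: lerXn2r; rewrite ?nnegrE ?mulr_ge0 ?addr_ge0 //.
  exact: ltW.
have detK : \det K = 0.
  apply: (cvg_unique (@Rhausdorff R) (cvg_det MK)).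
  rewrite (_ : (fun N => \det (M N)) = fun=> 0); first exact: cvg_cst.
  apply/funext => N; exact: (det_recurrence_eq0 N (u := fun n => c n * n`!%:R)
    (fun a i => x a ^+ i / i`!%:R) (fun b j => (- x b) ^+ j / j`!%:R) kp Hg).
have x_inj : injective x.
  move=> a b /(mulIf (lt0r_neq0 eta0))/eqP; rewrite eqr_nat => /eqP; exact: val_inj.
have [y y0 yK] : exists2 y : 'rV_p, y != 0 & y *m K = 0 by apply/det0P/eqP.
have [_ /(_ y^T)] := ker _ _ x_inj.
rewrite trmx_eq0 trmxK => /(_ y0).
rewrite (_ : \matrix_(i, j) _ = K) ?yK ?mul0mx ?mxE ?ltxx //.
by apply/matrixP => a b; rewrite !mxE stat even_f.
Qed.

(** * Fixed-size L-ensembles *)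

Lemma odd_taylor_coef_eq0 (R : realType) (f : R -> R) m :
  order_at_least m (smoothness_order f) ->
  forall k, odd k -> (k < (2 * m).-1)%N -> taylor_coef f k = 0.
Proof.
move=> f_order k ok km; apply/eqP/negPn/negP => ck.
have nz : nonzero_odd_coef f k.+1./2.
  rewrite /nonzero_odd_coef (_ : (2 * k.+1./2 - 1)%N = k) ?ck; last by lia.
  by rewrite andbT; lia.
move: f_order; rewrite /smoothness_order; case: pselect => [h|]; last first.
  by case; exists k.+1./2.
case: ex_minnP => r _ /(_ _ nz) rk /= mr; lia.
Qed.

Lemma det_vandermonde_gram (R : realType) n (x : 'I_n -> R) k (A : {set 'I_n}) :
  #|A| = k.+1 ->
  \det (principal_submx (vandermonde_le x k *m (vandermonde_le x k)^T) A) =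
  \det (Vandermonde #|A| (\row_a x (enum_val a))) ^+ 2.
Proof.
move=> cA; rewrite expr2 -[X in X * _]det_tr -det_mulmx; congr (\det _).
apply/matrixP => a b; rewrite !mxE.
under eq_bigr do rewrite !mxE.
under [RHS]eq_bigr do rewrite !mxE.
by rewrite -(big_mkord xpredT (fun j => x (enum_val a) ^+ j * x (enum_val b) ^+ j))
  -cA big_mkord.
Qed.

(** Total mass one determines the proportionality constant, and shows that the
    sum of the minors is nonzero. *)
Lemma fixed_size_LensembleE (R : realType) (d : measure_display)
    (T : measurableType d) (P : probability T R) n (X : T -> {set 'I_n}) m
    (L : 'M[R]_n) :
  fixed_size_Lensemble P X m L ->
  let Z := \sum_(B : {set 'I_n} | #|B| == m) \det (principal_submx L B) in
  Z != 0 /\ forall A, P (X @^-1` [set A]) =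
    (if #|A| == m then \det (principal_submx L A) / Z else 0)%:E.
Proof.
move=> [Xm [c Pc]] Z.
have total : \sum_(A : {set 'I_n}) P (X @^-1` [set A]) = 1%E.
  rewrite (big_enum_val (A := predT)) -measure_bigsetU_ord //; last first.
    by move=> i j _ _ /(trivIset_preimage1 (D := setT) I I)/enum_val_inj.
  rewrite -classical_sets.bigcup_seq -[RHS](probability_setT P); congr (P _).
  apply/seteqP; split => // t _.
  exists (enum_rank_in (isT : X t \in predT) (X t)).
    by rewrite /= mem_index_enum.
  by rewrite /= enum_rankK_in.
have cZ : c * Z = 1.
  move: total; under eq_bigr do rewrite Pc.
  by rewrite sumEFin -big_mkcond -mulr_sumr => -[].
have Z0 : Z != 0 by apply: contra_eq_neq cZ => ->; rewrite mulr0 eq_sym oner_neq0.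
split=> // A; rewrite Pc; case: ifP => // _.
by rewrite mulrC -[c](mulfK Z0) cZ mul1r.
Qed.

Theorem theorem4p5 (R : realType) (n m : nat) (x : 'I_n -> R)
    (x_inj : injective x) (m_bounds : (1 <= m <= n)%N)
    (kappa : R -> R -> R) (f : R -> R)
    (kappa_ker : is_kernel kappa) (kappa_stat : is_stationary kappa f)
    (f_analytic : analytic_near0 f)
    (f_order : order_at_least m (smoothness_order f))
    (d : R -> measure_display) (T : forall e : R, measurableType (d e))
    (P : forall e : R, probability (T e) R)
    (X : forall e : R, T e -> {set 'I_n})
    (X_law : forall e : R, 0 < e ->
       fixed_size_Lensemble (P e) (X e) m (kernel_mx (scaled_kernel f e) x))
    (dstar : measure_display) (Tstar : measurableType dstar)
    (Pstar : probability Tstar R) (Xstar : Tstar -> {set 'I_n})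
    (Xstar_law : fixed_size_Lensemble Pstar Xstar m
       (vandermonde_le x m.-1 *m (vandermonde_le x m.-1)^T)) :
  forall A : {set 'I_n},
    P e (X e @^-1` [set A]) @[e --> 0^'+] --> Pstar (Xstar @^-1` [set A]).
Proof.
move=> A; case/andP: m_bounds => m0 _.
have odd0 := odd_taylor_coef_eq0 f_order.
have W0 : \det (wronskian_mx f m) != 0.
  exact: wronskian_det_neq0 kappa_ker kappa_stat f_analytic odd0.
have [Z0 PstarE] := fixed_size_LensembleE Xstar_law.
pose Lstar := vandermonde_le x m.-1 *m (vandermonde_le x m.-1)^T.
pose L e := kernel_mx (scaled_kernel f e) x.
pose r e : R := (\prod_(i < m) (e ^+ i)^-1) ^+ 2.
have r0 e : 0 < e -> r e != 0.
  move=> e0; rewrite expf_neq0 //; apply/prodf_neq0 => i _.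
  by rewrite invr_neq0 // expf_neq0 // gt_eqF.
have minor_cvg (B : {set 'I_n}) : #|B| == m ->
    r e * \det (principal_submx (L e) B) @[e --> 0^'+] -->
    \det (wronskian_mx f m) * \det (principal_submx Lstar B).
  move=> /eqP cB; rewrite det_vandermonde_gram; last by rewrite prednK.
  have z_inj : injective (fun a : 'I_#|B| => x (enum_val a)).
    by move=> a b /x_inj/enum_val_inj.
  have odd0B k : odd k -> (k < (2 * #|B|).-1)%N -> taylor_coef f k = 0.
    by rewrite cB; exact: odd0.
  have -> : \det (wronskian_mx f m) = \det (wronskian_mx f #|B|) by rewrite cB.
  apply: cvg_trans _ (flat_limit_det f_analytic odd0B z_inj).
  apply: near_eq_cvg; near=> e; rewrite /r -cB; congr (_ * \det _).
  by apply/matrixP => a b; rewrite !mxE.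
have Z_cvg : \sum_(B : {set 'I_n} | #|B| == m)
      r e * \det (principal_submx (L e) B) @[e --> 0^'+] -->
    \sum_(B : {set 'I_n} | #|B| == m)
      \det (wronskian_mx f m) * \det (principal_submx Lstar B).
  by apply: cvg_big => [|B Bm]; [exact: add_continuous | exact: minor_cvg].
rewrite PstarE; case: ifPn => [Am|nAm]; last first.
  apply: cvg_near_cst; near=> e.
  have e0 : 0 < e by near: e; exact: nbhs_right_gt.
  by have [_ ->] := fixed_size_LensembleE (X_law e e0); rewrite (negPf nAm).
have WZ0 : \sum_(B : {set 'I_n} | #|B| == m)
      \det (wronskian_mx f m) * \det (principal_submx Lstar B) != 0.
  by rewrite -mulr_sumr mulf_neq0.
pose ratio e := r e * \det (principal_submx (L e) A) /
  (\sum_(B : {set 'I_n} | #|B| == m) r e * \det (principal_submx (L e) B)).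
have ratio_cvg : ratio e @[e --> 0^'+] -->
    \det (wronskian_mx f m) * \det (principal_submx Lstar A) /
    (\sum_(B : {set 'I_n} | #|B| == m)
      \det (wronskian_mx f m) * \det (principal_submx Lstar B)).
  by apply: cvgM; [exact: minor_cvg | exact: cvgV].
have ratioE : \det (principal_submx Lstar A) /
    (\sum_(B : {set 'I_n} | #|B| == m) \det (principal_submx Lstar B)) =
    (\det (wronskian_mx f m) * \det (principal_submx Lstar A)) /
    (\sum_(B : {set 'I_n} | #|B| == m)
      \det (wronskian_mx f m) * \det (principal_submx Lstar B)).
  by rewrite -mulr_sumr invfM mulrACA mulfV // mul1r.
rewrite ratioE.
have PE e : 0 < e -> P e (X e @^-1` [set A]) = (ratio e)%:E.
  move=> e0; have [_ ->] := fixed_size_LensembleE (X_law e e0).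
  rewrite Am /ratio -mulr_sumr; congr (_%:E).
  by rewrite invfM mulrACA mulfV ?mul1r // r0.
apply: cvg_EFin.
  by near=> e; rewrite PE //; near: e; exact: nbhs_right_gt.
apply: cvg_trans _ ratio_cvg; apply: near_eq_cvg.
near=> e; rewrite /= PE //; near: e; exact: nbhs_right_gt.
Unshelve. all: by end_near. Qed.
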